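(* Let $m,N,p$ be natural numbers with $m\geq 3$, $m\mid N$, $m<N$, and let $p$ be prime with $p\equiv -1\pmod m$. Write $N=\sum_i d_i p^i$ in base $p$ (so $0\le d_i<p$), and set $$A=\sum_{i\text{ even}}d_i,\qquad B=\sum_{i\text{ odd}}d_i.$$ Then $$v_p(G(N;m))=\begin{cases}2,& (A,B)=(1,1)\text{ and }p=m-1,\\ 1,& (A,B)=(1,1)\text{ and }m<p,\\ 1,& (A,B)=(m,0)\text{ or }(A,B)=(0,m),\\ 0,&\text{otherwise.}\end{cases}$$
   Context: For integers $m\ge 2$ and $N$ with $m\mid N$, define $G(N;m)=\gcd\left\{\binom Nk:0<k<N,\ m\mid k\right\}$, where $k$ ranges over integers. For a prime $p$ and a positive integer $x$, $v_p(x)$ denotes the exponent of $p$ in $x$. Digit positions are indexed from $i=0$ (the units digit). *)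

(* Defs.v *)
From mathcomp Require Import all_boot all_order all_algebra.

Set Implicit Arguments.
Unset Strict Implicit.
Unset Printing Implicit Defensive.

Definition binom_gcd (N m : nat) : nat :=
  \big[gcdn/0]_(1 <= k < N | m %| k) 'C(N, k).

(* The entry of index [i] of [d] is the coefficient of [p ^ i]. Trailing zeros
   are allowed; they affect neither the value nor the sums below. *)
Definition base_digits (p N : nat) (d : seq nat) : Prop :=
  (forall i, i < size d -> nth 0 d i < p) /\
  N = \sum_(i < size d) nth 0 d i * p ^ i.

Definition even_digit_sum (d : seq nat) : nat :=
  \sum_(i < size d | ~~ odd i) nth 0 d i.

Definition odd_digit_sum (d : seq nat) : nat :=
  \sum_(i < size d | odd i) nth 0 d i.

(* Main.v *)
Require Import Defs.
From mathcomp Require Import all_boot all_order all_algebra.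
From mathcomp Require Import zify.

(* By Kummer's theorem the exponent of [p] in ['C(N, k)] is the number of carries
   in the base-[p] addition of [k] and [N - k]. As [p ^ i] is [1] or [-1] modulo
   [m] according to the parity of [i], [m %| k] says that the even and odd digit
   sums of [k] agree modulo [m]. A carry-free [k] is a digitwise subfamily of
   [N], and a proper nonzero one with [m %| k] is available except when [(A, B)]
   is [(1, 1)], [(m, 0)] or [(0, m)]. In these cases a [k] with few carries comes
   from trading a unit [p ^ e] of [N] for [p] units [p ^ (e - 1)], which lie in
   the other parity class:
   - [(m, 0)] and [(0, m)]: [k = p ^ (e - 1) + p ^ q] with [p ^ q] another unit
     of [N];
   - [(1, 1)] and [m < p]: [k = m p ^ (e - 1)];
   - [(1, 1)] and [p = m - 1]: one trade is not enough, and trading once more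
     gives [k = p ^ (e - 1) + p ^ (e - 2)], with two carries. *)

(** * Base-[p] expansions and borrows *)

Definition digit_value (p : nat) (f : nat -> nat) (n : nat) : nat :=
  \sum_(i < n) f i * p ^ i.

(** Parity is a parameter so that the symmetric cases [(m, 0)] and [(0, m)] share one proof;
    [b = false] gives [A]. *)
Definition class_sum (b : bool) (f : nat -> nat) (n : nat) : nat :=
  \sum_(i < n | odd i == b) f i.

Definition digit (p k i : nat) : nat := k %/ p ^ i %% p.

(* Whether subtracting [f] from [g] in base [p] borrows from position [t]; for
   [f <= g] this is the carry into position [t] when adding [f] and [g - f]. *)
Definition borrow (p : nat) (g f : nat -> nat) (t : nat) : bool :=
  digit_value p g t < digit_value p f t.

Section DigitFunctions.

Variable p : nat.
Hypothesis p_gt0 : 0 < p.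

Lemma digit_valueS (f : nat -> nat) n :
  digit_value p f n.+1 = digit_value p f n + f n * p ^ n.
Proof. exact: big_ord_recr. Qed.

Lemma digit_value_lt (f : nat -> nat) n :
  (forall i, f i < p) -> digit_value p f n < p ^ n.
Proof.
move=> fp; elim: n => [|n IHn]; first by rewrite /digit_value big_ord0.
by rewrite digit_valueS expnS; have := fp n; nia.
Qed.

Lemma digit_value_mod (f : nat -> nat) n t :
  (forall i, f i < p) -> t <= n -> digit_value p f n %% p ^ t = digit_value p f t.
Proof.
move=> fp le_tn; rewrite -(subnKC le_tn); elim: (n - t) => [|j IHj].
  by rewrite addn0 modn_small // digit_value_lt.
by rewrite addnS digit_valueS expnD mulnCA mulnC addnC modnMDl.
Qed.

Lemma digit_value_digit k t : digit_value p (digit p k) t = k %% p ^ t.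
Proof.
elim: t => [|t IHt]; first by rewrite /digit_value big_ord0 expn0 modn1.
rewrite digit_valueS IHt /digit.
have pt_gt0 : 0 < p ^ t by rewrite expn_gt0 p_gt0.
have E : k = k %/ p ^ t %/ p * p ^ t.+1 + (k %% p ^ t + k %/ p ^ t %% p * p ^ t).
  by rewrite {1}(divn_eq k (p ^ t)) {1}(divn_eq (k %/ p ^ t) p) expnS; lia.
rewrite [in RHS]E modnMDl [RHS]modn_small // expnS.
have := ltn_pmod k pt_gt0; have := ltn_pmod (k %/ p ^ t) p_gt0; nia.
Qed.

Lemma digit_lt k i : digit p k i < p.
Proof. exact: ltn_pmod. Qed.

(** Truncated values stay below [p ^ t], so the comparison is decided at digit [t], with the
    incoming borrow breaking ties. *)
Lemma borrowS (g f : nat -> nat) t :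
    (forall i, g i < p) -> (forall i, f i < p) ->
  borrow p g f t.+1 = (g t < f t + borrow p g f t).
Proof.
move=> gp fp; rewrite /borrow !digit_valueS.
have := digit_value_lt g t gp; have := digit_value_lt f t fp.
move: (digit_value p g t) (digit_value p f t) (p ^ t) => x y q yq xq.
case: (ltnP x y) => xy /=; case: (ltnP _ (f t + _)) => h; apply/idP/idP; nia.
Qed.

Lemma borrow0 (g f : nat -> nat) : borrow p g f 0 = false.
Proof. by rewrite /borrow /digit_value !big_ord0. Qed.

End DigitFunctions.

(** * Legendre's and Kummer's formulas *)

(** Terms with [n < p ^ t.+1] vanish, so the range can be fixed by [M]; Kummer's theorem then
    compares three factorials term by term. *)
Lemma logn_fact_wide p n M :
  prime p -> n < p ^ M -> logn p n`! = \sum_(t < M) n %/ p ^ t.+1.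
Proof.
move=> p_pr nM; rewrite logn_fact // big_add1 /= big_mkord.
have widen K L : K <= L -> (forall t, K <= t -> n < p ^ t.+1) ->
    \sum_(t < L) n %/ p ^ t.+1 = \sum_(t < K) n %/ p ^ t.+1.
  move=> KL Kn; rewrite -(subnKC KL) big_split_ord /=.
  by rewrite [X in _ + X]big1 ?addn0 // => i _; rewrite divn_small // Kn // leq_addr.
have p1 := prime_gt1 p_pr.
rewrite -(widen n (maxn n M)) ?leq_maxl //; last first.
  by move=> t nt; apply: leq_ltn_trans nt _; rewrite ltnW // ltn_expl.
rewrite (widen M) ?leq_maxr // => t Mt; apply: leq_trans nM _.
by rewrite leq_exp2l // ltnW.
Qed.

(* Kummer's theorem. *)
Lemma logn_bin p N k M : prime p -> k <= N -> N < p ^ M ->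
  logn p 'C(N, k) = \sum_(t < M) (N %% p ^ t.+1 < k %% p ^ t.+1).
Proof.
move=> p_pr kN NM.
have /(congr1 (logn p)) := bin_fact kN.
rewrite !lognM ?muln_gt0 ?fact_gt0 ?bin_gt0 // !(@logn_fact_wide p _ M) //; try lia.
rewrite -!big_split /= => E; apply/eqP.
rewrite -(eqn_add2r (\sum_(i < M) (k %/ p ^ i.+1 + (N - k) %/ p ^ i.+1))) E.
rewrite -big_split /=; apply/eqP/eq_bigr => i _.
have pi_gt0 : 0 < p ^ i.+1 by rewrite expn_gt0 prime_gt0.
have {1 2}-> : N = k + (N - k) by rewrite subnKC.
(* The carry appears as a test that the two remainders add up to at least [p ^ i.+1], which holds
   exactly when the remainder of the sum falls below that of [k]. *)
rewrite divnD // modnD // addnC; congr (_ + _); congr nat_of_bool.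
have := ltn_pmod k pi_gt0; have := ltn_pmod (N - k) pi_gt0.
case: leqP => /=; rewrite ?mul1n; lia.
Qed.

(** * Digit sums over a parity class *)

Lemma class_sumD b (f g : nat -> nat) n :
  class_sum b (fun s => f s + g s) n = class_sum b f n + class_sum b g n.
Proof. exact: big_split. Qed.

(** The explicit witnesses below are sums of such terms, written with [1 *] where needed so that
    this evaluates their digit sums. *)
Lemma class_sum_delta b i n c : i < n ->
  class_sum b (fun s => c * (s == i)) n = c * (odd i == b).
Proof.
move=> lt_in; rewrite /class_sum big_mkcond (bigD1 (Ordinal lt_in)) //= eqxx muln1.
rewrite big1 => [|j]; first by rewrite addn0; case: eqP; lia.
by rewrite -val_eqE /= => /negPf->; rewrite muln0 if_same.
Qed.

Lemma leq_class_sum b (f g : nat -> nat) n :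
  (forall i, i < n -> odd i = b -> f i <= g i) -> class_sum b f n <= class_sum b g n.
Proof. by move=> fg; apply: leq_sum => i /eqP; apply: fg. Qed.

Lemma class_sum_lt b (f g : nat -> nat) n : class_sum b f n < class_sum b g n ->
  exists i, [/\ i < n, odd i = b & f i < g i].
Proof.
move=> lt_fg; case: (pickP (fun i : 'I_n => (odd i == b) && (f i < g i))) => [i|no].
  by case/andP=> /eqP ib fg; exists i.
suff : class_sum b g n <= class_sum b f n by lia.
apply: leq_sum => i ib; have := no i; rewrite ib /=; lia.
Qed.

Lemma class_sum_total b (f : nat -> nat) n :
  \sum_(i < n) f i = class_sum b f n + class_sum (~~ b) f n.
Proof.
rewrite (bigID (fun i : 'I_n => odd i == b)) /=; congr (_ + _).
by apply: eq_bigl => i; case: odd; case: b.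
Qed.

Lemma class_sum0 b n : class_sum b (fun=> 0) n = 0.
Proof. by rewrite /class_sum big1. Qed.

Lemma class_sum_gt0 b (g : nat -> nat) n : 0 < class_sum b g n ->
  exists i, [/\ i < n, odd i = b & 0 < g i].
Proof. by move=> S_gt0; apply: (@class_sum_lt b (fun=> 0)); rewrite class_sum0. Qed.

Lemma class_sum_eq (f g : nat -> nat) n :
    (forall i, i < n -> f i <= g i) ->
    (forall b, class_sum b f n = class_sum b g n) ->
  forall i, i < n -> f i = g i.
Proof.
move=> fg Sfg i lt_in; apply/eqP; rewrite eqn_leq fg //=.
have : class_sum (odd i) g n <= class_sum (odd i) f n by rewrite Sfg.
rewrite /class_sum (bigD1 (Ordinal lt_in)) //= [X in _ <= X](bigD1 (Ordinal lt_in)) //=.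
have : \sum_(j < n | (odd j == odd i) && (j != Ordinal lt_in)) f j <=
       \sum_(j < n | (odd j == odd i) && (j != Ordinal lt_in)) g j.
  by apply: leq_sum => j _; apply: fg.
move=> le_rest le_sum.
by rewrite -(leq_add2r (\sum_(j < n | (odd j == odd i) && (j != Ordinal lt_in)) f j))
           (leq_trans _ le_sum) ?leq_add2l.
Qed.

Lemma exists_class_sum b (g : nat -> nat) n c : c <= class_sum b g n ->
  exists f, [/\ forall i, f i <= g i, class_sum b f n = c & class_sum (~~ b) f n = 0].
Proof.
elim: c => [_|c IHc lt_cg].
  by exists (fun=> 0); split=> //; apply: class_sum0.
have [f [fg Sf Sf']] := IHc (ltnW lt_cg).
have [|i [lt_in ib fgi]] := @class_sum_lt b f g n; first by rewrite Sf.
exists (fun s => f s + 1 * (s == i)); split => [s||].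
- by rewrite mul1n; have [->|_] := eqVneq s i; rewrite ?addn1 // addn0 fg.
- by rewrite class_sumD class_sum_delta // ib eqxx Sf addn1.
- by rewrite class_sumD class_sum_delta // ib Sf'; case: (b).
Qed.

(** * Digit functions, divisibility by [m], and carries *)

Lemma digit_value_gt0 p (f : nat -> nat) n :
  0 < digit_value p f n -> exists b, 0 < class_sum b f n.
Proof.
case: (posnP (class_sum false f n)) => [S0|]; last by exists false.
case: (posnP (class_sum true f n)) => [S1|]; last by exists true.
rewrite /digit_value big1 // => i _.
have <- // : 0 = f i.
by apply: (@class_sum_eq (fun=> 0) f n) => // -[]; rewrite class_sum0.
Qed.

Lemma digit_value_modp1 p m (f : nat -> nat) n : 0 < p -> m %| p.+1 ->
  digit_value p f n = class_sum false f n + p * class_sum true f n %[mod m].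
Proof.
move=> p_gt0 mp.
have pX i : p ^ i = (if odd i then p else 1) %[mod m].
  elim: i => // i IHi; rewrite expnS -modnMmr IHi modnMmr /=.
  case: (odd i); last by rewrite muln1.
  have -> : p * p = p.-1 * p.+1 + 1 by nia.
  by case/dvdnP: mp => q ->; rewrite mulnA modnMDl.
rewrite /digit_value /class_sum big_distrr /= (bigID (fun i : 'I_n => odd i == false)) /=.
rewrite -modnDm -[RHS]modnDm; congr ((_ + _) %% _).
  rewrite -modn_summ -[RHS]modn_summ; congr (_ %% _); apply: eq_bigr => i /eqP io.
  by rewrite -modnMmr pX io modnMmr muln1.
rewrite -modn_summ -[RHS]modn_summ; congr (_ %% _); apply: eq_big => i; first by case: odd.
rewrite eqbF_neg negbK => io.
by rewrite -modnMmr pX io modnMmr mulnC.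
Qed.

Lemma dvdn_digit_value p m (f : nat -> nat) n : 0 < p -> m %| p.+1 ->
  (m %| digit_value p f n) = (class_sum false f n == class_sum true f n %[mod m]).
Proof.
move=> p_gt0 mp; rewrite /dvdn digit_value_modp1 // -(mod0n m).
(* Adding the odd sum to both sides turns its coefficient [p] into [p.+1], a multiple of [m]. *)
rewrite -(eqn_modDr (class_sum true f n)) add0n -addnA -mulSnr.
by case/dvdnP: mp => q ->; rewrite mulnAC addnC modnMDl.
Qed.

Lemma digit_value_inj p (f g : nat -> nat) n :
    (forall i, f i < p) -> (forall i, g i < p) ->
    digit_value p f n = digit_value p g n ->
  forall i, i < n -> f i = g i.
Proof.
move=> fp gp fg i lt_in; have p_gt0 : 0 < p by apply: leq_ltn_trans (fp 0).
have trunc t : t <= n -> digit_value p f t = digit_value p g t.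
  by move=> tn; rewrite -(digit_value_mod p p_gt0 f n) // fg digit_value_mod.
have := trunc _ lt_in; rewrite !digit_valueS (trunc i (ltnW lt_in)).
by move/addnI/eqP; rewrite eqn_pmul2r ?expn_gt0 ?p_gt0 // => /eqP.
Qed.

Lemma logn_bin_digit_value p (f g : nat -> nat) n :
    prime p -> (forall i, f i < p) -> (forall i, g i < p) ->
    ~~ borrow p g f n ->
  logn p 'C(digit_value p g n, digit_value p f n) = \sum_(t < n) borrow p g f t.+1.
Proof.
move=> p_pr fp gp nb; have p_gt0 := prime_gt0 p_pr.
rewrite (@logn_bin _ _ _ n) ?digit_value_lt // 1?leqNgt //.
by apply: eq_bigr => t _; rewrite !digit_value_mod.
Qed.

(** * Upper and lower bounds for the valuation of the gcd *)

Section BinomGcd.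

Variables (p m n : nat) (g : nat -> nat).
Hypotheses (p_pr : prime p) (mp : m %| p.+1) (gp : forall i, g i < p).

Let N := digit_value p g n.
Let p_gt0 := prime_gt0 p_pr.

Lemma binom_gcd_dvd k : 0 < k < N -> m %| k -> binom_gcd N m %| 'C(N, k).
Proof.
case/andP=> k_gt0 lt_kN mk; rewrite /binom_gcd big_geq_mkord.
by apply: (biggcdn_inf (Ordinal lt_kN)); rewrite //= mk.
Qed.

(** Here [f] gives the digits of a witness [k] and [e] marks the positions that may receive a carry;
    everywhere else the digits of [N] absorb [f] and the incoming carry. The last two hypotheses on
    [f] ensure [k != 0] and [k != N]. *)
Lemma logn_binom_gcd_le (f : nat -> nat) (e : pred nat) b i :
    (forall s, f s < p) -> (forall s, s < n -> ~~ e s.+1 -> f s + e s <= g s) ->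
    ~~ e n -> class_sum b f n = class_sum (~~ b) f n %[mod m] ->
    0 < class_sum b f n -> i < n -> f i != g i ->
  logn p (binom_gcd N m) <= \sum_(t < n) e t.+1.
Proof.
move=> fp feg en Sf Sf_gt0 lt_in fgi.
have be t : t <= n -> borrow p g f t <= e t.
  elim: t => [|t IHt] le_tn; first by rewrite borrow0.
  rewrite borrowS //; case et: (e t.+1); first exact: leq_b1.
  by have := feg t le_tn; have := IHt (ltnW le_tn); rewrite et /=; lia.
have nb : ~~ borrow p g f n by have := be n (leqnn n); rewrite (negPf en); case: borrow.
have k_gt0 : 0 < digit_value p f n.
  have [j [lt_jn _ fj]] := class_sum_gt0 _ _ _ Sf_gt0.
  rewrite lt0n; apply: contraTneq fj => k0; rewrite -leqNgt.
  suff -> : f j = (fun=> 0) j by [].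
  apply: (digit_value_inj p) lt_jn => //.
  by rewrite k0 /digit_value big1.
have lt_kN : digit_value p f n < N.
  rewrite ltn_neqAle [X in _ && X]leqNgt nb andbT.
  by apply: contraNneq fgi => /digit_value_inj-> //.
have mk : m %| digit_value p f n.
  by rewrite dvdn_digit_value //; apply/eqP; move: Sf; case: (b).
apply: leq_trans (dvdn_leq_log _ _ (binom_gcd_dvd _ _ mk)) _.
- by rewrite bin_gt0 ltnW.
- by rewrite k_gt0.
rewrite logn_bin_digit_value //; apply: leq_sum => t _; exact: be.
Qed.

Lemma leq_logn_binom_gcd c : 0 < m < N ->
    (forall f : nat -> nat, (forall i, f i < p) -> ~~ borrow p g f n ->
       class_sum false f n = class_sum true f n %[mod m] ->
       (exists b, 0 < class_sum b f n) ->
       (exists2 i, i < n & f i != g i) ->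
     c <= \sum_(t < n) borrow p g f t.+1) ->
  c <= logn p (binom_gcd N m).
Proof.
(* The index [m] is itself admissible, so the gcd is nonzero and its valuation is tested by
   divisibility. *)
move=> mN le_c; have G_gt0 : 0 < binom_gcd N m.
  apply: dvdn_gt0 (binom_gcd_dvd _ mN (dvdnn m)).
  by rewrite bin_gt0 ltnW //; case/andP: mN.
rewrite -pfactor_dvdn // /binom_gcd big_geq_mkord.
apply/dvdn_biggcdP=> [[k lt_kN]] /= /andP[mk k_gt0].
have kE : digit_value p (digit p k) n = k.
  by rewrite digit_value_digit // modn_small //; apply: ltn_trans lt_kN _; apply: digit_value_lt.
have dp i : digit p k i < p by apply: digit_lt.
have nb : ~~ borrow p g (digit p k) n by rewrite /borrow kE -leqNgt ltnW.
have C_gt0 : 0 < 'C(N, k) by rewrite bin_gt0 ltnW.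
rewrite pfactor_dvdn // -kE logn_bin_digit_value //.
apply: le_c => //.
- by apply/eqP; rewrite -(dvdn_digit_value p m) ?kE.
- by apply: (digit_value_gt0 p); rewrite kE.
- case: (pickP (fun i : 'I_n => digit p k i != g i)) => [i dg|no]; first by exists i.
  suff : k = N by lia.
  by rewrite -kE; apply: eq_bigr => i _; have /negbFE/eqP-> := no i.
Qed.
Lemma sum_eqn_le1 K j : \sum_(t < K) (t.+1 == j) <= 1.
Proof.
have -> : \sum_(t < K) (t.+1 == j) = (0 < j <= K) :> nat; last exact: leq_b1.
by elim: K => [|K IHK]; [rewrite big_ord0; lia | rewrite big_ord_recr IHK /=; lia].
Qed.

Lemma logn_binom_gcd_eq0 (f : nat -> nat) b b' :
    (forall s, f s <= g s) -> class_sum b f n = class_sum (~~ b) f n %[mod m] ->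
    0 < class_sum b f n -> class_sum b' f n < class_sum b' g n ->
  logn p (binom_gcd N m) = 0.
Proof.
move=> fg Sf Sf_gt0 /class_sum_lt[i [lt_in _ fgi]]; apply/eqP; rewrite -leqn0.
apply: leq_trans (logn_binom_gcd_le f pred0 b i _ _ _ Sf Sf_gt0 lt_in _) _ => //.
- by move=> s; apply: leq_ltn_trans (gp s).
- by move=> s _ _; rewrite addn0.
- by rewrite ltn_eqF.
- by rewrite big1.
Qed.

Lemma no_borrow_leq (f : nat -> nat) : (forall i, f i < p) ->
  \sum_(t < n) borrow p g f t.+1 = 0 -> forall i, i < n -> f i <= g i.
Proof.
move=> fp /eqP; rewrite sum_nat_eq0 => /forallP nb i lt_in.
by have := nb (Ordinal lt_in); rewrite /= eqb0 borrowS // -leqNgt; lia.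
Qed.

(** * Carry-free witnesses and the pure cases *)

Hypotheses (m_gt2 : 2 < m) (lt_mN : m < N).

Let p_gt1 := prime_gt1 p_pr.
Let range_m : 0 < m < N. Proof. by rewrite lt_mN; lia. Qed.
Let p_ge : m <= p.+1. Proof. exact: dvdn_leq. Qed.

Lemma logn_binom_gcd_eq0_mixed b b' :
    0 < class_sum b g n -> 0 < class_sum (~~ b) g n -> 1 < class_sum b' g n ->
  logn p (binom_gcd N m) = 0.
Proof.
move=> /class_sum_gt0[i [lt_in ib gi]] /class_sum_gt0[j [lt_jn jb gj]] S_gt1.
(* One unit from each class gives digit sums [(1, 1)]; the class [b'], with at least two units,
   keeps the witness proper. *)
have Sf b0 : class_sum b0 (fun s => 1 * (s == i) + 1 * (s == j)) n = 1.
  by rewrite class_sumD !class_sum_delta // ib jb; case: (b); case: b0.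
apply: (logn_binom_gcd_eq0 (fun s => 1 * (s == i) + 1 * (s == j)) b b'); rewrite ?Sf // => s.
have [->|_] := eqVneq s i; have [E|_] //= := eqVneq _ j; last by rewrite E.
by move: jb; rewrite -E ib; case: (b).
Qed.

Lemma logn_binom_gcd_eq0_pure b :
  m < class_sum b g n -> logn p (binom_gcd N m) = 0.
Proof.
move=> lt_mS; have [f [fg Sf Sf']] := exists_class_sum _ _ _ _ (ltnW lt_mS).
by apply: (logn_binom_gcd_eq0 f b b); rewrite // Sf ?Sf' ?modnn ?mod0n //; lia.
Qed.

(** Without carries [f] is digitwise below [g]; its congruent, not both zero, digit sums are then
    forced to equal those of [g], hence [f = g]. *)
Lemma borrow_sum_gt0 b (f : nat -> nat) :
    class_sum b g n = 1 /\ class_sum (~~ b) g n = 1 \/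
    class_sum b g n = m /\ class_sum (~~ b) g n = 0 ->
    (forall i, f i < p) -> class_sum false f n = class_sum true f n %[mod m] ->
    (exists b, 0 < class_sum b f n) -> (exists2 i, i < n & f i != g i) ->
  0 < \sum_(t < n) borrow p g f t.+1.
Proof.
move=> Sg fp Sf [b0 Sf_gt0] [i lt_in fgi]; rewrite lt0n.
apply/eqP => /(no_borrow_leq _ fp) fg.
have {}Sf : class_sum b f n = class_sum (~~ b) f n %[mod m] by move: Sf; case: (b).
have Sfg b1 : class_sum b1 f n <= class_sum b1 g n by apply: leq_class_sum => j lt_jn _; apply: fg.
have /class_sum_eq E : forall b1, class_sum b1 f n = class_sum b1 g n; last first.
  by rewrite E ?eqxx in fgi.
suff [E1 E2] : class_sum b f n = class_sum b g n /\
                class_sum (~~ b) f n = class_sum (~~ b) g n.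
  by move=> b1; case: (eqVneq b1 b) => [->//|]; move: E1 E2; case: (b); case: b1.
have pos : 0 < class_sum b f n \/ 0 < class_sum (~~ b) f n.
  by move: Sf_gt0; case: (b); case: b0; auto.
have := Sfg b; have := Sfg (~~ b); case: Sg => [[-> ->] y1 x1|[-> ->] y0 xm].
  by rewrite !modn_small in Sf; lia.
move: y0 Sf; rewrite leqn0 => /eqP y0; rewrite y0 mod0n in pos * => Sf.
have /dvdn_leq : m %| class_sum b f n by apply/eqP.
lia.
Qed.

Lemma logn_binom_gcd_gt0 b :
    class_sum b g n = 1 /\ class_sum (~~ b) g n = 1 \/
    class_sum b g n = m /\ class_sum (~~ b) g n = 0 ->
  0 < logn p (binom_gcd N m).
Proof.
by move=> Sg; apply: (leq_logn_binom_gcd 1) => // f fp _; apply: (borrow_sum_gt0 b).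
Qed.

Lemma logn_binom_gcd_le1_pure b :
  class_sum b g n = m -> class_sum (~~ b) g n = 0 -> logn p (binom_gcd N m) <= 1.
Proof.
move=> Sm S0.
(* If only the units digit were nonzero, [N] would equal its digit sum [m]. *)
have [e [lt_en e_gt0 ge]] : exists e, [/\ e < n, 0 < e & 0 < g e].
  case: (pickP (fun i : 'I_n => (0 < i) && (0 < g i))) => [i /andP[]|no].
    by exists i.
  suff NE : N = \sum_(i < n) g i by move: lt_mN; rewrite NE (class_sum_total b) Sm S0; lia.
  apply: eq_bigr => i _; have := no i; case: posnP => [->|_] /=; first by rewrite muln1.
  by case: posnP => // ->.
have le_eg s : 1 * (s == e) <= g s by case: eqP => [->|].
have Se : class_sum b (fun s => 1 * (s == e)) n < class_sum b g n.
  by rewrite class_sum_delta // Sm; case: eqP; lia.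
have eb : odd e = b.
  have := leq_class_sum (~~ b) _ _ n (fun s _ _ => le_eg s).
  by rewrite S0 class_sum_delta //; case: odd; case: (b).
(* A unit other than the one traded at [e]; [q = e] is possible when [g e] is at least 2. *)
have [q [lt_qn qb ge_q]] := class_sum_lt _ _ _ _ Se.
have e1b : odd e.-1 = ~~ b by rewrite -eb -{2}(prednK e_gt0) /= negbK.
have lt_e1n : e.-1 < n by lia.
have neq_qe1 : q != e.-1 by apply: contra_eq_neq qb => ->; rewrite e1b; case: (b).
have g0 : g e.-1 = 0.
  apply/eqP; rewrite -leqn0 -S0 /class_sum (bigD1 (Ordinal lt_e1n)) ?leq_addr //=.
  by rewrite e1b.
have Sf b1 : class_sum b1 (fun s => 1 * (s == q) + 1 * (s == e.-1)) n = 1.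
  by rewrite class_sumD !class_sum_delta // qb e1b; case: (b); case: b1.
apply: leq_trans (logn_binom_gcd_le (fun s => 1 * (s == q) + 1 * (s == e.-1))
         (pred1 e) b e.-1 _ _ _ _ _ _ _) _.
- move=> s; have [->|_] := eqVneq s q; last by case: eqP; lia.
  by rewrite (negPf neq_qe1).
- move=> s lt_sn /= s1e.
  have -> : (s == e.-1) = false by lia.
  have [sq|_] := eqVneq s q; last by have := le_eg s; lia.
  by move: ge_q; rewrite -sq; lia.
- by rewrite /= gtn_eqF.
- by rewrite !Sf.
- by rewrite Sf.
- by [].
- by rewrite g0 eqxx addn1.
exact: sum_eqn_le1.
Qed.

(** * The case of digit sums [(1, 1)] *)

Section OneOne.

Hypothesis Sg : forall b, class_sum b g n = 1.

Lemma logn_binom_gcd_le1_mixed : m < p -> logn p (binom_gcd N m) <= 1.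
Proof.
(* The odd unit is the one traded, since its position cannot be 0. *)
move=> lt_mp; have [j [lt_jn jodd gj]] : exists i, [/\ i < n, odd i & 0 < g i].
  by apply: (class_sum_gt0 true); rewrite Sg.
have j_gt0 := odd_gt0 jodd.
have lt_j1n : j.-1 < n by lia.
have j1even : odd j.-1 = false by move: jodd; rewrite -{1}(prednK j_gt0) /=; case: odd.
have gj1 : g j.-1 <= 1.
  rewrite -(Sg false) /class_sum (bigD1 (Ordinal lt_j1n)) ?leq_addr //=.
  by rewrite j1even.
apply: leq_trans (logn_binom_gcd_le (fun s => m * (s == j.-1)) (pred1 j) false j.-1 _ _ _ _ _ _ _) _.
- by move=> s; case: eqP; rewrite ?muln1 ?muln0.
- move=> s lt_sn /= s1j.
  have -> : (s == j.-1) = false by lia.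
  by rewrite muln0; case: eqP => // ->.
- by rewrite /= gtn_eqF.
- by rewrite !class_sum_delta // j1even muln1 muln0 modnn mod0n.
- by rewrite class_sum_delta // j1even muln1; lia.
- by [].
- by rewrite eqxx muln1; lia.
exact: sum_eqn_le1.
Qed.

Hypothesis pE : p.+1 = m.

Lemma logn_binom_gcd_le2 : logn p (binom_gcd N m) <= 2.
Proof.
(* Two trades need a unit at position 2 or higher; otherwise [N] would be at most [p + 1 = m]. *)
have [j [lt_jn j_gt1 gj]] : exists j, [/\ j < n, 1 < j & 0 < g j].
  case: (pickP (fun i : 'I_n => (1 < i) && (0 < g i))) => [i /andP[]|no].
    by exists i.
  suff : N <= m by lia.
  have gs0 (i : 'I_n) : 1 < i -> g i = 0.
    by move=> i1; have := no i; rewrite i1 /=; case: posnP.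
  rewrite -pE -addn1 /N /digit_value (bigID (fun i : 'I_n => odd i == true)) /=.
  apply: leq_add.
    rewrite -[leqRHS]muln1 -(Sg true) /class_sum big_distrr /=.
    apply: leq_sum => i io; have [/gs0->|] := ltnP 1 i; first by rewrite muln0.
    by case: (nat_of_ord i) io => [|[|]] //= _ _; rewrite expn1 mulnC.
  rewrite -(Sg false) /class_sum.
  rewrite (eq_bigl (fun i : 'I_n => odd i == false)); last by move=> i; case: odd.
  apply: leq_sum => i io; have [/gs0->|] := ltnP 1 i; first by [].
  by case: (nat_of_ord i) io => [|[|]] //= _ _; rewrite muln1.
have jE : j = j.-2.+2 by lia.
have Sf b : class_sum b (fun s => 1 * (s == j.-1) + 1 * (s == j.-2)) n = 1.
  have [lt1 lt2] : j.-1 < n /\ j.-2 < n by lia.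
  rewrite class_sumD !class_sum_delta //.
  by rewrite jE /=; case: odd; case: b.
apply: leq_trans (logn_binom_gcd_le (fun s => 1 * (s == j.-1) + 1 * (s == j.-2))
         (pred2 j.-1 j) false j _ _ _ _ _ _ _) _.
- by move=> s; lia.
- move=> s lt_sn /=; rewrite negb_or => /andP[s1 s2].
  have [sj|_] := eqVneq s j; last by lia.
  by rewrite sj; lia.
- by rewrite /=; lia.
- by rewrite !Sf.
- by rewrite Sf.
- by [].
- by lia.
apply: leq_trans (leq_add (sum_eqn_le1 n j.-1) (sum_eqn_le1 n j)).
rewrite -big_split; apply: leq_sum => t _ /=.
by case: eqP; case: eqP.
Qed.

(* A single carry, out of position [t], would force a zero digit sum of [k] in
   the parity class of [t.+1] and one between [1] and [p] in that of [t]; these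
   are not congruent modulo [m = p.+1]. *)
Lemma logn_binom_gcd_ge2 : 1 < logn p (binom_gcd N m).
Proof.
apply: leq_logn_binom_gcd => // f fp nb Sf f_gt0 fg; rewrite leqNgt; apply/negP => lt2.
have := borrow_sum_gt0 false f (or_introl (conj (Sg _) (Sg _))) fp Sf f_gt0 fg.
case: (pickP (fun t : 'I_n => borrow p g f t.+1)) => [[t lt_tn] /= bt _|no]; last first.
  by rewrite big1 // => i _; rewrite no.
have only s : s < n -> s != t -> ~~ borrow p g f s.+1.
  move=> lt_sn st; move: lt2; rewrite (bigD1 (Ordinal lt_tn)) //= bt.
  by rewrite (bigD1 (Ordinal lt_sn)) -?val_eqE //=; case: borrow.
have bt0 : borrow p g f t = false.
  case: t lt_tn bt only => [|t] lt_tn _ only; first exact: borrow0.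
  by apply: negbTE; apply: only; lia.
have gft : g t < f t by move: bt; rewrite borrowS // bt0 addn0.
have lt_t1n : t.+1 < n.
  have : t.+1 != n by apply: contraNneq nb => <-.
  lia.
have fgS s : s < n -> s != t -> f s + borrow p g f s <= g s.
  by move=> lt_sn st; have := only s lt_sn st; rewrite borrowS // -leqNgt.
have ft1 : f t.+1 < g t.+1.
  by have := fgS _ lt_t1n (negbT (gtn_eqF (ltnSn t))); rewrite bt addn1.
(* The carry uses up the only unit of [g] in this class, leaving nothing for [f]. *)
have S1 : class_sum (odd t.+1) f n = 0.
  have : class_sum (odd t.+1) (fun s => f s + 1 * (s == t.+1)) n <= class_sum (odd t.+1) g n.
    apply: leq_class_sum => s lt_sn ps; have [->|_] := eqVneq s t.+1; first by rewrite addn1.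
    rewrite addn0; apply: leq_trans (fgS s lt_sn _); first exact: leq_addr.
    by apply: contra_eq_neq ps => ->; rewrite /=; case: odd.
  by rewrite class_sumD class_sum_delta // Sg eqxx; lia.
have S_gt0 : 0 < class_sum (odd t) f n.
  have : class_sum (odd t) (fun s => 1 * (s == t)) n <= class_sum (odd t) f n.
    by apply: leq_class_sum => s _ _; case: eqP => [->|//]; lia.
  by rewrite class_sum_delta // eqxx.
(* The digit at [t] is at most [p.-1] and [f <= g] elsewhere, so the total is at most
   [1 + p.-1 = p]. *)
have S_le : class_sum (odd t) f n <= p.
  have : class_sum (odd t) f n <= class_sum (odd t) (fun s => g s + p.-1 * (s == t)) n.
    apply: leq_class_sum => s lt_sn _; have [->|st] := eqVneq s t; first by have := fp t; lia.
    by rewrite muln0 addn0; apply: leq_trans (fgS s lt_sn st); apply: leq_addr.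
  by rewrite class_sumD class_sum_delta // Sg eqxx; lia.
have : class_sum (odd t) f n = class_sum (odd t.+1) f n %[mod m].
  by move: Sf; rewrite /=; case: odd.
by rewrite S1 mod0n modn_small -?pE ?ltnS //; lia.
Qed.
End OneOne.
End BinomGcd.

(** * Case analysis on the two digit sums *)

Theorem theorem1p1 (m N p : nat) (d : seq nat)
    (hm : 3 <= m) (hmN : m %| N) (hltN : m < N)
    (hp : prime p) (hpm : (p%:Z = - 1 %[mod m%:Z])%Z)
    (hd : base_digits p N d) :
  let A := even_digit_sum d in
  let B := odd_digit_sum d in
  logn p (binom_gcd N m) =
    if ((A, B) == (1, 1)) && (p == m - 1) then 2
    else if ((A, B) == (1, 1)) && (m < p) then 1
    else if ((A, B) == (m, 0)) || ((A, B) == (0, m)) then 1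
    else 0.
Proof.
move=> A B; case: hd => dp NE.
pose g := nth 0 d; pose n := size d.
have p_gt1 := prime_gt1 hp.
have gp i : g i < p.
  (* Past the end of [d] the default digit 0 is still below [p]. *)
  by have [/dp//|le_di] := ltnP i (size d); rewrite /g nth_default //; lia.
have {}NE : N = digit_value p g n by [].
have AE : class_sum false g n = A by apply: eq_bigl => i; case: odd.
have BE : class_sum true g n = B by apply: eq_bigl => i; case: odd.
have mp : m %| p.+1.
  by move/eqP: hpm; rewrite eqz_mod_dvd GRing.opprK -PoszD addn1.
have hltN' : m < digit_value p g n by rewrite -NE.
have ABm : A = B %[mod m] by apply/eqP; rewrite -AE -BE -(dvdn_digit_value p) -?NE // ltnW.
have p_ge : m <= p.+1 by apply: dvdn_leq.
rewrite NE !xpair_eqE.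
have [/andP[/eqP A1 /eqP B1]|not11] := boolP ((A == 1) && (B == 1)).
  have Sg b : class_sum b g n = 1 by case: b; rewrite ?AE ?BE.
  rewrite /=; have [pE|p_neq] := eqVneq p (m - 1).
    by apply/eqP; rewrite eqn_leq logn_binom_gcd_le2 ?logn_binom_gcd_ge2 //; lia.
  (* Only [m = p] remains to be excluded, and it would make [m] divide 1. *)
  have lt_mp : m < p.
    have : m != p by apply: contraL mp => /eqP->; rewrite -addn1 dvdn_addr // dvdn1; lia.
    lia.
  rewrite lt_mp; apply/eqP; rewrite eqn_leq logn_binom_gcd_le1_mixed //=.
  by apply: (logn_binom_gcd_gt0 p m n g _ _ _ _ _ false) => //; left.
(* With one class empty the other sum is a positive multiple of [m]: equal to [m] it gives valuation
   1, larger it gives 0. *)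
have pure b : 0 < class_sum b g n -> class_sum (~~ b) g n = 0 ->
    logn p (binom_gcd (digit_value p g n) m) = (class_sum b g n == m).
  move=> S_gt0 S0; have mS : m %| class_sum b g n.
    by apply/eqP; move: ABm S0; rewrite -AE -BE; case: (b) => /= E1 E2; rewrite E2 mod0n in E1.
  have := dvdn_leq S_gt0 mS; case: ltngtP => // [lt_mS|Sm] _.
    exact: (logn_binom_gcd_eq0_pure p m n g _ _ _ _ _ b).
  apply/eqP; rewrite eqn_leq (logn_binom_gcd_le1_pure p m n g _ _ _ _ _ b) //=.
  by apply: (logn_binom_gcd_gt0 p m n g _ _ _ _ _ b) => //; right.
rewrite /=; have [A0|A_gt0] := posnP A.
  have B_gt0 : 0 < B.
    have [|[] S_gt0] := digit_value_gt0 p g n; first by lia.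
      by rewrite -BE.
    by rewrite AE A0 in S_gt0.
  rewrite (pure true) ?BE ?AE // A0.
  have -> : (0 == m) = false by lia.
  by rewrite /=; case: (B == m).
have [B0|B_gt0] := posnP B.
  rewrite (pure false) ?BE ?AE // B0.
  have -> : (0 == m) = false by lia.
  by rewrite andbT andbF orbF; case: (A == m).
rewrite andbF /=.
(* Both sums are positive and not both 1, so one is at least 2: [B] if [A = 1], and [A]
   otherwise. *)
have [A1|A_neq1] := eqVneq A 1.
  by apply: (logn_binom_gcd_eq0_mixed p m n g _ _ _ true true);
    rewrite // ?BE ?AE //; move: not11; lia.
by apply: (logn_binom_gcd_eq0_mixed p m n g _ _ _ false false);
  rewrite // ?BE ?AE //; lia.
Qed.
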